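(* Let $X\subseteq Z$ and $X'\subseteq Z'$ be finite metric spaces with $d_{GH}((X,Z),(X',Z'))=\varepsilon$, and let $f_0$, $f'_0$ be the linear maps induced by the inclusions. Then there is a partial matching $\sigma\colon\mathrm{Rep}\,D(f_0)\nrightarrow\mathrm{Rep}\,D(f'_0)$ such that: (i) for every $((a,b),i)$ in the domain of $\sigma$, writing $\sigma((a,b),i)=((a',b'),j)$, either $a=a'=\infty$ or $|a-a'|\le 2\varepsilon$, and $|b-b'|\le2\varepsilon$; (ii) for every unmatched $((a,b),i)\in\mathrm{Rep}\,D(f_0)$, either $a=\infty$ or $a\le2\varepsilon$, and $b\le 2\varepsilon$; (iii) for every unmatched $((a',b'),j)\in\mathrm{Rep}\,D(f'_0)$, either $a'=\infty$ or $a'\le 2\varepsilon$, and $b'\le2\varepsilon$.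
   Context: All vector spaces are over $\mathbb{Z}_2$. For a finite metric space $X$, $\mathrm{VR}_r(X)$ is the graph on $X$ with edges $[x,y]$ for $d^X(x,y)\le r$; $\mathrm{PH}_0(X)$ is the persistence module $r\mapsto H_0(\mathrm{VR}_r(X))$ (free on connected components) with structure maps $\rho_{rs}$ induced by inclusion, so $\mathrm{PH}_0(X)_0$ has basis $X$; $m^U(b)$ denotes the multiplicity of the bar $[0,b)$ ($b<\infty$) in the interval decomposition of $U$. For $X\subseteq Z$ let $V=\mathrm{PH}_0(X)$, $U=\mathrm{PH}_0(Z)$, $f_0\colon V_0\to U_0$ the inclusion-induced linear map; with $\ker^+_b(U)=\ker(\rho^U_{0b})$ and $\ker^-_b(U)=\bigcup_{0\le r<b}\ker(\rho^U_{0r})$, define for $a,b>0$: $\mathcal{M}^0_f(a,b)=\dim\frac{f_0(\ker^+_a V)\cap \ker^+_b U}{f_0(\ker^-_a V)\cap\ker^+_b U+f_0(\ker^+_a V)\cap \ker^-_b U}$ and $N_f(b)=m^U(b)-\sum_{a>0}\mathcal{M}^0_f(a,b)$. The matching diagram $D(f_0)$ is the multiset of pairs $(a,b)\in(\mathbb{R}\cup\{\infty\})\times\mathbb{R}$ with multiplicity $\mathcal{M}^0_f(a,b)$ if $a<\infty$ and $N_f(b)$ if $a=\infty$, keeping only pairs of positive multiplicity. For a multiset $(S,m)$, $\mathrm{Rep}(S,m)=\{(s,\ell):s\in S,1\le\ell\le m(s)\}$; a partial matching is a bijection between subsets of the two representations. Gromov–Hausdorff distance of pairs: $d_{GH}((X,Z),(X',Z'))$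 is the infimum over metric spaces $M$ and isometric embeddings $\gamma_Z\colon Z\to M$, $\gamma_{Z'}\colon Z'\to M$ of $\max\{d^M_H(\gamma_Z(X),\gamma_{Z'}(X')),d^M_H(\gamma_Z(Z),\gamma_{Z'}(Z'))\}$, where $d^M_H$ is the Hausdorff distance. *)

(* Defs.v *)
From HB Require Import structures.
From mathcomp Require Import all_boot all_order all_algebra.
From mathcomp Require Import boolp classical_sets fsbigop reals.
Set Implicit Arguments. Unset Strict Implicit. Unset Printing Implicit Defensive.
Import Order.TTheory GRing.Theory Num.Theory.
Local Open Scope ring_scope.

Notation F2 := ('F_2)%type.

Notation free T := {ffun T -> F2^o}.

Section Defs.
Variable R : realType.

Definition is_metric (T : Type) (d : T -> T -> R) : Prop :=
  (forall x y, 0 <= d x y) /\ (forall x y, d x y = 0 <-> x = y) /\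
  (forall x y, d x y = d y x) /\ (forall x y z, d x z <= d x y + d y z).

Definition vspan (T : finType) (P : pred (free T)) : {vspace free T} :=
  <<[seq v <- enum (free T) | P v]>>%VS.

(* Image of a subspace under a map (span of the image set; the maps used
   below are linear, so this is the image subspace). *)
Definition vimg (T T' : finType) (f : free T -> free T') (S : {vspace free T})
  : {vspace free T'} :=
  <<[seq f v | v <- enum (free T) & v \in S]>>%VS.

Section PH0.
Variables (T : finType) (d : T -> T -> R).

Definition vr_rel (r : R) : rel T := fun x y => d x y <= r.

(* Structure map rho_{0r} : PH_0(T)_0 -> PH_0(T)_r. The free vector space on
   the connected components of VR_r is represented by the functions on T that
   are constant on components; the basis vector x of PH_0(T)_0 is sent to the
   indicator function of its component. *)
Definition rho0 (r : R) (v : free T) : free T :=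
  [ffun y => \sum_(x | connect (vr_rel r) y x) v x].

Definition kerp (b : R) : {vspace free T} := vspan [pred v | rho0 b v == 0].

(* ker^-_b = union over 0 <= r < b of ker rho_{0r} (a nested union of
   subspaces, which is itself the subspace spanned by it). *)
Definition kerm (b : R) : {vspace free T} :=
  vspan [pred v | `[< exists r : R, 0 <= r /\ r < b /\ rho0 r v = 0 >] ].

(* m^{PH_0(T)}(b): multiplicity of the bar [0,b) (b < oo) in the interval
   decomposition of PH_0(T), i.e. dim ker^+_b - dim ker^-_b (all bars of PH_0
   are born at 0). *)
Definition mbar (b : R) : nat := (\dim (kerp b) - \dim (kerm b))%N.
End PH0.

Section Matching.
Variables (Z : finType) (dZ : Z -> Z -> R) (X : {set Z}).

Definition subX := {x : Z | x \in X}.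
Definition dX (x y : subX) : R := dZ (val x) (val y).

Definition f0 (v : free subX) : free Z :=
  [ffun z => match (insub z : option subX) with Some x => v x | None => 0 end].

(* M^0_f(a,b) for a, b > 0 (0 otherwise: not part of the diagram).  Both
   summands of the denominator lie in the numerator, so the dimension of the
   quotient is the difference of dimensions. *)
Definition M0 (a b : R) : nat :=
  if (0 < a) && (0 < b) then
    (\dim (vimg f0 (kerp dX a) :&: kerp dZ b) -
     \dim ((vimg f0 (kerm dX a) :&: kerp dZ b) +
           (vimg f0 (kerp dX a) :&: kerm dZ b)))%N
  else 0%N.

Definition Nf (b : R) : int :=
  (mbar dZ b)%:Z - \sum_(a \in [set a : R | 0 < a]) (M0 a b)%:Z.

(* Multiplicity of (a,b) in the matching diagram D(f_0); a = None stands
   for a = infinity. *)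
Definition Dmult (p : option R * R) : int :=
  if 0 < p.2 then
    match p.1 with Some a => (M0 a p.2)%:Z | None => Nf p.2 end
  else 0.

Definition inRep (q : (option R * R) * nat) : Prop :=
  (1 <= q.2)%N /\ (q.2)%:Z <= Dmult q.1.
End Matching.

Definition hausdorff (M : Type) (dM : M -> M -> R) (A B : set M) : R :=
  Num.max (sup [set inf [set dM a b | b in B] | a in A])
          (sup [set inf [set dM a b | a in A] | b in B]).

Definition isometric (T M : Type) (dT : T -> T -> R) (dM : M -> M -> R)
  (g : T -> M) : Prop := forall x y, dM (g x) (g y) = dT x y.

Definition dGH_pair (Z Z' : finType) (dZ : Z -> Z -> R) (X : {set Z})
  (dZ' : Z' -> Z' -> R) (X' : {set Z'}) : R :=
  inf [set t : R | exists (M : Type) (dM : M -> M -> R) (g : Z -> M) (g' : Z' -> M),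
        [/\ is_metric dM, isometric dZ dM g, isometric dZ' dM g' &
        t = Num.max (hausdorff dM (g @` [set x | x \in X]) (g' @` [set x | x \in X']))
                    (hausdorff dM (g @` setT) (g' @` setT))]].
End Defs.

(* Main.v *)
(** Let E be the space of 0-chains of Z. The maps ker^+ of PH_0(X) and PH_0(Z)
    give two filtrations of E, that is, two ultrametric valuations a and b,
    where a = oo on the chains that die in no PH_0(X)_r. A basis of E
    adapted to both filtrations exists (choose greedily a vector outside of the
    current span minimizing (a, b) lexicographically), and the points (a, b) of
    its elements with b < oo form the matching diagram, with N_f counting the
    points with a = oo.

    A correspondence of distortion 2 eps between the pairs yields maps
    h : Z -> Z' and k : Z' -> Z whose linear extensions shift both valuations by
    at most delta = 2 eps. Let P and Q be their matrices in adapted bases. Then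
    PQ is the identity up to an error that only sees points with coordinates at
    most delta (or a = oo). If a + b at e_i is at most a + b at e_l and P_ij and
    Q_jl are nonzero, the point of e'_j is delta-close to that of e_i or of e_l.
    So for a set S of large points with delta-neighbourhood N, the product of
    the S x N and N x S blocks is unitriangular for the order given by a + b,
    whence |S| <= |N|; Hall's theorem matches the large points, and the
    Mendelsohn-Dulmage theorem combines the matchings of the two directions. *)
Require Import Defs.
From HB Require Import structures.
From mathcomp Require Import all_boot all_order all_algebra.
From mathcomp Require Import boolp classical_sets fsbigop reals.
From mathcomp Require Import lra.
(* Imported again so that finset takes precedence over classical_sets. *)
From mathcomp Require Import fintype finset.
Import Order.TTheory GRing.Theory Num.Theory.
Set Implicit Arguments. Unset Strict Implicit. Unset Printing Implicit Defensive.
Local Open Scope ring_scope.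

(** * Bipartite matchings, and a rank criterion for Hall's condition *)

Section Matchings.
Variables (I J : finType).

(** Induction on the size of [S]. If some nonempty proper subset [A] is tight, [A] is matched first,
    then [S :\: A] in the graph without the neighbours of [A]. Otherwise every nonempty proper
    subset has a neighbour to spare, so any edge at [x] can be fixed. The point [j0] gives a total
    [f] even when [S] is empty. *)
Lemma hall_marriage (N : I -> J -> bool) (S : {set I}) (j0 : J) :
  (forall A : {set I}, A \subset S ->
     (#|A| <= #|[set j | [exists i in A, N i j]]|)%N) ->
  exists f : I -> J,
    {in S &, injective f} /\ (forall i, i \in S -> N i (f i)).
Proof.
have [n leSn] := ubnP #|S|; elim: n S N leSn => // n IHn S N /ltnSE-leSn hallN.
have [->|[x xS]] := set_0Vmem S.
  by exists (fun=> j0); split=> [i i'|i]; rewrite inE.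
pose nbr (A : {set I}) := [set j | [exists i in A, N i j]].
have [/existsP[A /and4P[sAS A0 AS /eqP cardA]]|noA] := boolP [exists A : {set I},
    [&& A \subset S, A != set0, A != S & #|nbr A| == #|A|]].
  have ltAS : (#|A| < #|S|)%N by apply: proper_card; rewrite properEneq AS.
  have [|f [fI fN]] := IHn A N (leq_trans ltAS leSn).
    by move=> B sBA; apply: hallN; apply: subset_trans sAS.
  pose N' i j := N i j && (j \notin nbr A).
  have ltDS : (#|S :\: A| < n)%N.
    rewrite (leq_trans _ leSn)// cardsD (setIidPr sAS) ltn_subrL.
    by rewrite card_gt0 A0 (leq_ltn_trans _ ltAS).
  have [|g [gI gN]] := IHn (S :\: A) N' ltDS.
    move=> B sBD.
    have sBS : B \subset S by apply: subset_trans sBD (subsetDl _ _).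
    have dAB : [disjoint A & B].
      rewrite disjoint_sym disjoint_subset; apply: subset_trans sBD _.
      by apply/subsetP => i; rewrite !inE => /andP[].
    (* Hall's condition for [A :|: B], less the tight set [A], is Hall's condition for [B] in the
       reduced graph. *)
    have := hallN (A :|: B); rewrite subUset sAS sBS => /(_ isT).
    rewrite -/(nbr _) cardsU (disjoint_setI0 dAB) cards0 subn0 => leN.
    rewrite -(leq_add2l #|A|) (leq_trans leN)// -cardA.
    apply: leq_trans (leq_card_setU _ _); apply: subset_leq_card.
    apply/subsetP => j; rewrite !inE => /existsP[i /andP[iAB Nij]].
    have [//|/= jA] := boolP [exists i in A, N i j].
    move: iAB; rewrite inE => /orP[iA|iB].
      by case/negP: jA; apply/existsP; exists i; rewrite iA.
    by apply/existsP; exists i; rewrite iB /N' Nij inE jA.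
  exists (fun i => if i \in A then f i else g i); split=> [i i' iS i'S|i iS].
    have fnbr k : k \in A -> f k \in nbr A.
      by move=> kA; rewrite inE; apply/existsP; exists k; rewrite kA fN.
    have gnbr k : k \in S -> k \notin A -> g k \notin nbr A.
      by move=> kS kA; have /andP[] : N' k (g k) by apply: gN; rewrite inE kA.
    case: ifPn => iA; case: ifPn => i'A.
    - exact: fI.
    - by move=> e; move: (fnbr _ iA); rewrite e (negPf (gnbr _ i'S i'A)).
    - by move=> e; move: (fnbr _ i'A); rewrite -e (negPf (gnbr _ iS iA)).
    - by apply: gI; rewrite inE ?iA ?i'A.
  by case: ifPn => iA; [exact: fN | have /andP[] : N' i (g i) by apply: gN; rewrite inE iA].
have [y Nxy] : exists y, N x y.
  have := hallN [set x]; rewrite sub1set cards1 => /(_ xS); rewrite card_gt0.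
  by move/set0Pn => [y]; rewrite inE => /existsP[i /andP[/set1P-> ]]; exists y.
have ltDS : (#|S :\ x| < n)%N.
  by rewrite (leq_trans _ leSn)// [leqRHS](cardsD1 x) xS.
pose N' i j := N i j && (j != y).
have [|g [gI gN]] := IHn (S :\ x) N' ltDS.
  move=> A sAD; have [->|A0] := eqVneq A set0; first by rewrite cards0.
  have sAS : A \subset S by apply: subset_trans sAD (subsetDl _ _).
  have AS : A != S.
    by apply/eqP => eAS; move/subsetP/(_ x): sAD; rewrite eAS xS !inE eqxx => /(_ isT).
  have ltA : (#|A| < #|nbr A|)%N.
    rewrite ltn_neqAle hallN// andbT eq_sym; apply: contraNneq noA => e.
    by apply/existsP; exists A; rewrite sAS A0 AS e /=.
  have -> : [set j | [exists i in A, N' i j]] = nbr A :\ y.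
    apply/setP => j; rewrite !inE; apply/existsP/andP.
      by move=> [i /and3P[iA Nij jy]]; split=> //; apply/existsP; exists i; rewrite iA.
    by move=> [jy /existsP[i /andP[iA Nij]]]; exists i; rewrite iA /N' Nij.
  by move: ltA; rewrite (cardsD1 y (nbr A)); case: (y \in _); rewrite ?add1n ?ltnS// => /ltnW.
exists (fun i => if i == x then y else g i).
have gy i : i \in S -> i != x -> g i != y.
  by move=> iS ix; have /andP[] : N' i (g i) by apply: gN; rewrite !inE ix.
split=> [i i' iS i'S|i iS].
  case: eqVneq => [->|ix]; case: eqVneq => [->|i'x] //.
  - by move=> /esym/eqP; rewrite (negPf (gy _ i'S i'x)).
  - by move=> /eqP; rewrite (negPf (gy _ iS ix)).
  - by apply: gI; rewrite !inE ?ix ?i'x.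
case: eqVneq => [->//|ix].
by have /andP[] : N' i (g i) by apply: gN; rewrite !inE ix.
Qed.

(* As in the Schroeder-Bernstein theorem, [f] is used on the orbits of
   [g \o f] that start outside of the image of [g], and the inverse of [g]
   elsewhere. *)
Lemma mendelsohn_dulmage (N : I -> J -> bool) (S : {set I}) (S' : {set J})
    (f : I -> J) (g : J -> I) :
    {in S &, injective f} -> (forall i, i \in S -> N i (f i)) ->
    {in S' &, injective g} -> (forall j, j \in S' -> N (g j) j) ->
  exists tau : I -> option J,
    [/\ forall i j, tau i = Some j -> N i j,
        forall i i' j, tau i = Some j -> tau i' = Some j -> i = i',
        forall i, i \in S -> tau i <> None
      & forall j, j \in S' -> exists i, tau i = Some j].
Proof.
move=> fI fN gI gN.
pose next : rel I := fun i i' => [&& i \in S, f i \in S' & g (f i) == i'].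
pose W := [set i | [exists i0, [&& i0 \in S, i0 \notin g @: S' & connect next i0 i]]].
have Wstep i : i \in W -> i \in S -> f i \in S' -> g (f i) \in W.
  rewrite !inE => /existsP[i0 /and3P[h1 h2 h3]] iS fS.
  apply/existsP; exists i0; rewrite h1 h2 /=.
  by apply: connect_trans h3 (connect1 _); rewrite /next iS fS /=.
have Winv i : i \in W -> i \in g @: S' ->
    exists2 i', i' \in W & [/\ i' \in S, f i' \in S' & g (f i') = i].
  rewrite !inE => /existsP[i0 /and3P[h1 h2 /connectP[p]]].
  elim/last_ind: p => [_ -> ig|p i1 _]; first by rewrite ig in h2.
  rewrite rcons_path last_rcons => /andP[pth nx] ->{i} _.
  exists (last i0 p); last by case/and3P: nx => ? ? /eqP.
  by rewrite inE; apply/existsP; exists i0; rewrite h1 h2; apply/connectP; exists p.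
pose tau i := if i \in W then (if i \in S then Some (f i) else None)
              else [pick j in S' | g j == i].
exists tau; split.
- move=> i j; rewrite /tau; case: ifP => _.
    by case: ifP => // iS [<-]; exact: fN.
  by case: pickP => // j' /andP[jS /eqP<-] [<-]; exact: gN.
(* The two halves cannot collide: if [i] in [W] has [f i = j] and [i' = g j], then [i'] is the
   successor of [i] and lies in [W] too. *)
- have mixed i i' j : i \in W -> i' \notin W -> tau i = Some j ->
      tau i' = Some j -> False.
    rewrite /tau => iW i'W; rewrite iW (negPf i'W); case: ifP => // iS [<-].
    case: pickP => // j' /andP[jS /eqP e] [jf].
    by move/negP: i'W; apply; rewrite -e jf; apply: Wstep => //; rewrite -jf.
  move=> i i' j ti ti'.
  have [iW|iW] := boolP (i \in W); have [i'W|i'W] := boolP (i' \in W).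
  + move: ti ti'; rewrite /tau iW i'W.
    by case: ifP => // iS [<-]; case: ifP => // i'S [/fI]-> .
  + by case: (mixed i i' j).
  + by case: (mixed i' i j).
  + move: ti ti'; rewrite /tau (negPf iW) (negPf i'W).
    case: pickP => // j1 /andP[_ /eqP<-] [->].
    by case: pickP => // j2 /andP[_ /eqP<-] [->].
- move=> i iS; rewrite /tau iS; case: ifPn => // iW.
  case: pickP => // nog _; move/negP: iW; apply; rewrite inE.
  apply/existsP; exists i; rewrite iS connect0 andbT /=.
  by apply/imsetP => -[j jS e]; have := nog j; rewrite jS e eqxx.
- move=> j jS; have [gW|gW] := boolP (g j \in W).
    have [|i iW [iS fS /gI e]] := Winv _ gW; first exact: imset_f.
    by exists i; rewrite /tau iW iS e.
  exists (g j); rewrite /tau (negPf gW); case: pickP => [j' /andP[j'S /eqP/gI e]|/(_ j)].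
    by rewrite e.
  by rewrite jS eqxx.
Qed.

End Matchings.

(* A nonzero left-kernel vector of the [S x T] block of [P], paired with the
   column of [Q] indexed by the largest element of its support, would be both
   zero and nonzero. *)
Lemma triangular_product_card (R : realType) (F : fieldType) (I J : finType)
    (P : I -> J -> F) (Q : J -> I -> F) (s : I -> R) (S : {set I}) (T : {set J}) :
    (forall i k, i \in S -> k \in S -> s i <= s k ->
       \sum_(j in T) P i j * Q j k = (i == k)%:R) ->
  (#|S| <= #|T|)%N.
Proof.
move=> PQ; rewrite leqNgt; apply/negP => ltTS.
pose A : 'M[F]_(#|S|, #|T|) := \matrix_(i, j) P (enum_val i) (enum_val j).
have /rowV0Pn[c cK c0] : kermx A != 0.
  rewrite kermx_eq0 /row_free neq_ltn (leq_ltn_trans (rank_leq_col A))//.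
have cA : c *m A = 0 by apply/sub_kermxP.
have [k0 ck0] : exists k, c 0 k != 0.
  by move/rV0Pn: c0.
case: (@arg_maxP _ R _ k0 [pred k | c 0 k != 0] (fun k => s (enum_val k)) ck0) => k ck kmax.
move/eqP: ck; apply.
have : \sum_(j in T) (\sum_i c 0 i * P (enum_val i) j) * Q j (enum_val k) = 0.
  apply: big1 => j jT; have := congr1 (fun M : 'rV_ _ => M 0 (enum_rank_in jT j)) cA.
  rewrite !mxE; under eq_bigr do rewrite mxE enum_rankK_in//.
  by move=> ->; rewrite mul0r.
under eq_bigr do rewrite mulr_suml.
rewrite exchange_big /= (bigD1 k)//= [X in _ + X]big1 ?addr0.
  by under eq_bigr do rewrite -mulrA; rewrite -mulr_sumr PQ ?enum_valP// eqxx mulr1.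
move=> i ik; under eq_bigr do rewrite -mulrA; rewrite -mulr_sumr.
have [->|ci] := eqVneq (c 0 i) 0; first by rewrite mul0r.
rewrite PQ ?enum_valP//; last exact: kmax.
by rewrite (inj_eq enum_val_inj) (negPf ik) mulr0.
Qed.

Local Notation chain T := {ffun T -> ('F_2)^o}.

(** * Bases adapted to two ultrametric valuations *)

Section Valuations.
Variables (R : realType) (T : finType).
Implicit Types (u v : chain T) (s : seq (chain T)).

(** A single inequality saying that all nonempty sublevel sets of [w] are subspaces. *)
Definition ultrametric (w : chain T -> R) :=
  forall c u v, w (c *: u + v) <= Num.max (w u) (w v).

Lemma ultrametric_span (w : chain T -> R) s v (r : R) : ultrametric w ->
  w 0 <= r -> (forall x, x \in s -> w x <= r) -> v \in <<s>>%VS -> w v <= r.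
Proof.
move=> um w0 ws /(@coord_span _ _ _ (in_tuple s))->.
elim/big_ind: _ => // [x y wx wy|i _].
  by rewrite -[x]scale1r (le_trans (um _ _ _))// ge_max wx.
rewrite -[X in w X]addr0 (le_trans (um _ _ _))// ge_max w0 andbT.
by apply: ws; apply: mem_nth.
Qed.

Lemma ultrametric0 (w : chain T -> R) v : ultrametric w -> w 0 <= w v.
Proof. by move=> /(_ (-1) v v); rewrite scaleN1r addNr maxxx. Qed.

Variables alpha beta : chain T -> R.
Hypotheses (um_alpha : ultrametric alpha) (um_beta : ultrametric beta).

Definition lexle u v :=
  (alpha u < alpha v) || (alpha u == alpha v) && (beta u <= beta v).

Lemma lexle_min (P : pred (chain T)) v0 : P v0 ->
  exists2 v, P v & forall u, P u -> lexle v u.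
Proof.
move=> Pv0.
case: (@arg_minP _ R _ v0 P alpha Pv0) => v1 Pv1 min1.
have P1 : P v1 && (alpha v1 == alpha v1) by rewrite Pv1 eqxx.
case: (@arg_minP _ R _ v1 [pred v | P v && (alpha v == alpha v1)] beta P1).
move=> v /andP[Pv /eqP ev] minv; exists v => // u Pu.
rewrite /lexle ev; have := min1 u Pu; rewrite le_eqVlt => /orP[/eqP e|->//].
by rewrite e eqxx minv ?orbT//= Pu e eqxx.
Qed.

Definition greedy s :=
  forall i v, (i < size s)%N -> v \notin <<take i s>>%VS -> lexle s`_i v.

Lemma greedy_exists k : (k <= \dim {:chain T})%N ->
  exists s, [/\ size s = k, free s & greedy s].
Proof.
elim: k => [|k IHk] ltk; first by exists [::]; split=> //; exact: nil_free.
have [s [sz fs gs]] := IHk (ltnW ltk).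
have [v0 v0s] : exists v, v \notin <<s>>%VS.
  apply/existsP; rewrite -negb_forall; apply/negP => /forallP sall.
  move: ltk; rewrite -sz ltnNge => /negP; apply.
  by apply: leq_trans (dim_span s); apply: dimvS; apply/subvP => v _; exact: sall.
have [v vs minv] := @lexle_min [pred v | v \notin <<s>>%VS] v0 v0s.
exists (rcons s v); split; first by rewrite size_rcons sz.
  have -> : free (rcons s v) = free (v :: s) by apply: perm_free; rewrite perm_rcons.
  by rewrite free_cons fs andbT; exact: vs.
move=> i u; rewrite size_rcons ltnS leq_eqVlt => /orP[/eqP->|lti].
  by rewrite nth_rcons ltnn eqxx -cats1 take_size_cat//; exact: minv.
by rewrite nth_rcons lti -cats1 takel_cat 1?ltnW//; exact: gs.
Qed.

(** Induction on [k]. If [v] involves [s_k], then [alpha v <= alpha s_k], since [s_k] has the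
    largest [alpha] in the prefix. As [s_k] was preferred to [v], the two [alpha] agree and
    [beta s_k <= beta v]. Hence removing the [s_k] term from [v] raises neither valuation, and the
    induction hypothesis applies to the rest. *)
Lemma greedy_span s k v : free s -> greedy s -> (k <= size s)%N ->
  v \in <<take k s>>%VS ->
  v \in <<[seq x <- take k s | (alpha x <= alpha v)%R && (beta x <= beta v)%R]>>%VS.
Proof.
move=> fs gs; elim: k v => [|k IHk] v lek.
  by rewrite take0.
have sub u : alpha u <= alpha v -> beta u <= beta v -> u \in <<take k s>>%VS ->
    u \in <<[seq x <- take k.+1 s | (alpha x <= alpha v)%R && (beta x <= beta v)%R]>>%VS.
  move=> ua ub uk; apply: subvP (IHk u (ltnW lek) uk); apply: sub_span => x.
  rewrite !mem_filter => /andP[/andP[xa xb] xk] /=.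
  rewrite (le_trans xa)// (le_trans xb)//= (take_nth 0 lek).
  by rewrite mem_rcons inE xk orbT.
move=> vk1; have [vk|vk] := boolP (v \in <<take k s>>%VS); first exact: sub.
have := vk1; rewrite {1}(take_nth 0 lek) -cats1 span_cat span_seq1.
move=> /memv_addP[u us [_ /vlineP[c ->] ev]].
have skN i : (i <= k)%N -> s`_k \notin <<take i s>>%VS.
  move=> leik; have : free (s`_k :: take k s).
    have -> : free (s`_k :: take k s) = free (rcons (take k s) s`_k).
      by apply: perm_free; rewrite perm_sym perm_rcons.
    by rewrite -take_nth//; apply: (@catl_free _ _ (drop k.+1 s)); rewrite cat_take_drop.
  rewrite free_cons => /andP[skN _]; apply: contra skN.
  by apply: subvP; apply: sub_span => x; rewrite -(take_takel _ leik) => /mem_take.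
(* By freeness [s_k] is outside the span of every shorter prefix, so it competed in each earlier
   choice. *)
have a_max x : x \in take k.+1 s -> alpha x <= alpha s`_k.
  move=> /(nthP 0)[i]; rewrite size_takel// ltnS => leik; rewrite nth_take// => <-.
  have /orP[/ltW//|/andP[/eqP->//]] : lexle s`_i s`_k.
  by apply: gs; [exact: leq_ltn_trans lek|exact: skN].
have va : alpha v <= alpha s`_k.
  by apply: ultrametric_span vk1 => //; exact: ultrametric0.
have [/eqP ea sb] : alpha s`_k == alpha v /\ beta s`_k <= beta v.
  have /orP[|/andP//] : lexle s`_k v by exact: gs.
  by rewrite ltNge va.
have eu : u = - c *: s`_k + v by rewrite ev scaleNr addrC addrK.
have ua : alpha u <= alpha v.
  by rewrite eu (le_trans (um_alpha _ _ _))// ge_max ea !lexx.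
have ub : beta u <= beta v.
  by rewrite eu (le_trans (um_beta _ _ _))// ge_max sb lexx.
rewrite {1}ev; apply: rpredD; first exact: sub.
apply/rpredZ/memv_span; rewrite mem_filter ea lexx sb /=.
by rewrite (take_nth 0 lek) mem_rcons mem_head.
Qed.

(** A greedy sequence of full length is a basis, and [greedy_span] expands [v] in elements below it
    for both valuations; uniqueness of coordinates kills the others. *)
Lemma adapted_basis : exists e : (\dim {:chain T}).-tuple (chain T),
  basis_of fullv e /\
  forall v i, coord e i v != 0 -> alpha e`_i <= alpha v /\ beta e`_i <= beta v.
Proof.
have [s [sz fs gs]] := greedy_exists (leqnn _).
have sz' : size s == \dim {:chain T} by rewrite sz.
pose e := Tuple sz'.
have be : basis_of fullv e by rewrite basisEfree fs subvf /= sz leqnn.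
exists e; split=> // v i.
have : v \in <<take (size s) s>>%VS by rewrite take_size (span_basis be) memvf.
move=> /(greedy_span fs gs (leqnn _)); rewrite take_size => vs.
move=> ci; suff : (alpha e`_i <= alpha v) && (beta e`_i <= beta v) by move/andP.
apply: contraNT ci => out; rewrite (coord_span (X := in_tuple _) vs) linear_sum big1//.
move=> j _; rewrite linearZ /=.
have : (in_tuple [seq x <- s | (alpha x <= alpha v)%R && (beta x <= beta v)%R])`_j \in
    [seq x <- s | (alpha x <= alpha v)%R && (beta x <= beta v)%R] by apply: mem_nth.
rewrite mem_filter => /andP[ok /(nthP 0)[l lts el]]; rewrite -el in ok *.
rewrite sz in lts; rewrite (coord_free (X := e) (Ordinal lts) i fs).
by case: eqP => [ei|_]; [move: out; rewrite -ei ok | rewrite mulr0].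
Qed.
End Valuations.

(** * Subspaces spanned by parts of one basis: a Boolean algebra of index sets *)

Section BasisSubspaces.
Variables (K : fieldType) (V : vectType K) (n : nat) (e : n.-tuple V).
Hypothesis be : basis_of fullv e.
Implicit Types P Q : {set 'I_n}.

Definition bspan P : {vspace V} := <<[seq e`_(val i) | i <- enum P]>>%VS.

Lemma mem_bspan P v : reflect (forall i, coord e i v != 0 -> i \in P) (v \in bspan P).
Proof.
apply: (iffP idP) => [vP i|vP].
  apply: contraNT => iP; rewrite (coord_span (X := in_tuple _) vP) linear_sum big1//.
  move=> j _; rewrite linearZ /=.
  have := mem_nth 0 (ltn_ord j); move=> /mapP[l].
  rewrite mem_enum => lP ->; rewrite coord_free ?(basis_free be)//.
  by case: eqP => [li|_]; [move: iP; rewrite -li lP | rewrite mulr0].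
rewrite (coord_basis be (memvf v)); apply: rpred_sum => i _.
have [->|/vP iP] := eqVneq (coord e i v) 0; first by rewrite scale0r mem0v.
by apply/rpredZ/memv_span/map_f; rewrite mem_enum.
Qed.

Lemma dim_bspan P : \dim (bspan P) = #|P|.
Proof.
rewrite cardE -(size_map (fun i : 'I_n => e`_(val i))); apply/eqP.
rewrite -[_ == _]/(free _) (perm_free (Y := [seq x <- e | x \in [seq e`_(val i) | i <- enum P]])).
  exact/filter_free/(basis_free be).
have ue : uniq e by apply/free_uniq/(basis_free be).
have einj i j : (i < n)%N -> (j < n)%N -> e`_i = e`_j -> i = j.
  by move=> lti ltj /eqP; rewrite nth_uniq ?size_tuple// => /eqP.
apply: uniq_perm; rewrite ?filter_uniq//.
  rewrite map_inj_in_uniq ?enum_uniq// => i j _ _ eij.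
  exact/val_inj/(einj _ _ (ltn_ord i) (ltn_ord j)).
move=> x; rewrite mem_filter andb_idr// => /mapP[i _ ->].
by rewrite mem_nth// size_tuple ltn_ord.
Qed.

Lemma bspanI P Q : (bspan P :&: bspan Q)%VS = bspan (P :&: Q).
Proof.
apply/vspaceP => v; rewrite memv_cap; apply/andP/mem_bspan.
  by move=> [/mem_bspan vP /mem_bspan vQ] i ci; rewrite inE vP// vQ.
by move=> vPQ; split; apply/mem_bspan => i /vPQ; rewrite inE => /andP[].
Qed.

Lemma bspanU P Q : (bspan P + bspan Q)%VS = bspan (P :|: Q).
Proof.
apply/vspaceP => v; apply/memv_addP/mem_bspan.
  move=> [u /mem_bspan uP [w /mem_bspan wQ ->]] i; rewrite linearD inE /=.
  apply: contraR; rewrite negb_or => /andP[iP iQ].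
  have /eqP-> : coord e i u == 0 by apply: contraR iP => /uP.
  have /eqP-> : coord e i w == 0 by apply: contraR iQ => /wQ.
  by rewrite addr0.
move=> vPQ; exists (\sum_(i in P) coord e i v *: e`_i).
  apply: rpred_sum => i iP; apply/rpredZ/memv_span/(map_f (fun i : 'I_n => e`_(val i))).
  by rewrite mem_enum.
exists (\sum_(i | i \notin P) coord e i v *: e`_i); last first.
  by rewrite {1}(coord_basis be (memvf v)) (bigID (mem P)).
apply: rpred_sum => i iP.
have [->|/vPQ] := eqVneq (coord e i v) 0; first by rewrite scale0r mem0v.
rewrite inE (negPf iP) /= => iQ.
by apply/rpredZ/memv_span/(map_f (fun i : 'I_n => e`_(val i))); rewrite mem_enum.
Qed.

End BasisSubspaces.

(** * Kernels of the structure maps as annihilators of functions *)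

Section Annihilators.
Variables (R : realType) (T : finType) (d : T -> T -> R).
Implicit Types (X : {set T}) (r : R) (u v : chain T).

(** The degree 0 cocycles of VR_r(X), extended arbitrarily outside of [X]. *)
Definition locally_constant X r (g : T -> 'F_2) :=
  forall x y, x \in X -> y \in X -> d x y <= r -> g x = g y.

(* [killed X r v] says that [v] is supported on [X] and is in the kernel of
   the structure map from scale [0] to scale [r] of PH_0(X): kernels are
   described as annihilators of locally constant functions, and the support
   condition is the case of functions that vanish on [X]. *)
Definition killed X r v : bool :=
  `[< forall g, locally_constant X r g -> \sum_x v x * g x = 0 >].

Lemma killed_lin X r c u v : killed X r u -> killed X r v -> killed X r (c *: u + v).
Proof.
move=> /asboolP ku /asboolP kv; apply/asboolP => g gX.
under eq_bigr do rewrite !ffunE mulrDl -[_ *: _]/(_ * _) -mulrA.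
by rewrite big_split -mulr_sumr /= ku// kv// mulr0 addr0.
Qed.

Lemma killed0 X r : killed X r 0.
Proof.
by apply/asboolP => g _; apply: big1 => x _; rewrite ffunE mul0r.
Qed.

Lemma killed_le X r r' v : r <= r' -> killed X r v -> killed X r' v.
Proof.
move=> rr' /asboolP kv; apply/asboolP => g gX; apply: kv => x y xX yX dxy.
by apply: gX => //; apply: le_trans rr'.
Qed.

Lemma killed_supp X r v x : killed X r v -> x \notin X -> v x = 0.
Proof.
move=> /asboolP kv xX; have := kv (fun y => (y == x)%:R).
rewrite (bigD1 x)//= eqxx mulr1 big1 ?addr0.
  apply=> y z yX zX _; case: eqVneq yX => [->|_]; first by rewrite (negPf xX).
  by case: eqVneq zX => [->|_]; first by rewrite (negPf xX).
by move=> y /negPf->; rewrite mulr0.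
Qed.

(** A locally constant function is constant on components, so pairing with it is a combination of
    the sums of [v] over components, which are the values of [rho0]. Conversely, each such sum is a
    pairing with the indicator of a component. *)
Lemma rho0_eq0 r v : (forall x y, d x y = d y x) ->
  (rho0 d r v == 0) = killed [set: T] r v.
Proof.
move=> dsym; have csym : connect_sym (vr_rel d r).
  by apply: sym_connect_sym => x y; rewrite /vr_rel dsym.
apply/eqP/asboolP => [rv g gl|kv].
  have gc x y : connect (vr_rel d r) x y -> g x = g y.
    move=> /connectP[p]; elim: p x => [x _ ->//|z p IH x /= /andP[xz pth] ey].
    by rewrite -(IH z)//; apply: gl; rewrite ?inE.
  rewrite (partition_big (fingraph.root (vr_rel d r)) predT)//=; apply: big1 => y _.
  have [yy|yy] := eqVneq (fingraph.root (vr_rel d r) y) y; last first.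
    apply: big_pred0 => x; apply: contra_neqF yy => /eqP<-.
    exact: (root_root csym).
  transitivity ((rho0 d r v) y * g y); last by rewrite rv ffunE mul0r.
  rewrite ffunE mulr_suml; apply: eq_big => [x|x].
    by rewrite -{1}yy (root_connect csym) csym.
  by move=> /eqP xy; rewrite (gc x y)// -(root_connect csym) xy yy.
apply/ffunP => y; rewrite !ffunE.
have := kv (fun x => (connect (vr_rel d r) y x)%:R).
rewrite (bigID (connect (vr_rel d r) y)) /=.
rewrite [X in _ + X]big1 ?addr0; last by move=> x /negPf->; rewrite mulr0.
under eq_bigr => x yx do rewrite yx mulr1.
apply=> x z _ _ xz.
congr (_%:R); congr nat_of_bool; apply/idP/idP => yc; apply: connect_trans yc _.
  exact: connect1.
by rewrite csym; apply: connect1.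
Qed.

End Annihilators.

(** * The two kernel filtrations inside the chains of [Z] *)

Section Kernels.
Variables (R : realType) (Z : finType) (dZ : Z -> Z -> R).
Hypothesis dsym : forall x y, dZ x y = dZ y x.

(** Removes the spans from [kerp], [kerm] and [vimg], whose spanning sets are already subspaces. *)
Lemma span_closed (T : finType) (s : seq (chain T)) v :
    0 \in s -> (forall c x y, x \in s -> y \in s -> c *: x + y \in s) ->
  (v \in <<s>>%VS) = (v \in s).
Proof.
move=> s0 sl; apply/idP/idP; last exact: memv_span.
move=> /(@coord_span _ _ _ (in_tuple s))->.
elim/big_ind: _ => // [x y xs ys|i _]; first by rewrite -[x]scale1r; exact: sl.
by rewrite -[X in X \in _]addr0; apply: sl => //; apply: mem_nth.
Qed.

Lemma mem_kerp (T : finType) (d : T -> T -> R) b v : (forall x y, d x y = d y x) ->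
  (v \in kerp d b) = killed d [set: T] b v.
Proof.
move=> sd.
have E w : (w \in [seq w <- enum {ffun T -> ('F_2)^o} | rho0 d b w == 0])
    = killed d [set: T] b w.
  by rewrite mem_filter mem_enum andbT rho0_eq0.
rewrite span_closed ?E ?killed0// => c x y; rewrite !E; exact: killed_lin.
Qed.

Lemma mem_kerm (T : finType) (d : T -> T -> R) b v : (forall x y, d x y = d y x) ->
  0 < b -> (v \in kerm d b) = `[< exists2 r, 0 <= r < b & killed d [set: T] r v >].
Proof.
move=> sd b0.
have E w : (w \in [seq w <- enum {ffun T -> ('F_2)^o}
      | `[< exists r, 0 <= r /\ r < b /\ rho0 d r w = 0 >]])
    = `[< exists2 r, 0 <= r < b & killed d [set: T] r w >].
  rewrite mem_filter mem_enum andbT; apply/asboolP/asboolP => -[r].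
    by move=> [r0 [rb /eqP]]; rewrite rho0_eq0// => k; exists r => //; rewrite r0.
  by move=> /andP[r0 rb]; rewrite -rho0_eq0// => /eqP k; exists r.
rewrite span_closed ?E//.
  by apply/asboolP; exists 0; rewrite ?lexx// killed0.
move=> c x y; rewrite !E => /asboolP[r /andP[r0 rb] kr] /asboolP[r' /andP[r'0 r'b] kr'].
(* The union is nested: both chains have died at the larger of the two radii. *)
apply/asboolP; exists (Num.max r r').
  by rewrite le_max r0 gt_max rb.
by apply: killed_lin; [apply: killed_le kr|apply: killed_le kr'];
  rewrite le_max lexx ?orbT.
Qed.

Variable X : {set Z}.

(** The pairing with [f0 u] sees only the values on [X], where locally constant functions restrict
    to the subtype and, extended by zero, come back. *)
Lemma f0_killed r (u : chain (subX X)) :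
  killed dZ X r (f0 u) = killed (dX dZ (X:=X)) [set: subX X] r u.
Proof.
have pair g : \sum_z f0 u z * g z = \sum_x u x * g (val x).
  rewrite (bigID (mem X)) /= [X in _ + X]big1 ?addr0; last first.
    by move=> z zX; rewrite ffunE insubN ?mul0r.
  rewrite big_sub; apply: eq_bigr => x _.
  by rewrite ffunE valK.
apply/asboolP/asboolP => ku g gl; last first.
  by rewrite pair; apply: ku => x y _ _; apply: gl; exact: valP.
pose g' z := if insub z is Some x then g x else 0.
have := ku g'; rewrite pair; under eq_bigr do rewrite /g' valK.
apply=> z z' zX z'X; rewrite /g' !insubT => dzz'.
by apply: gl; rewrite ?inE.
Qed.

Lemma f0_linear c u v : f0 (X := X) (c *: u + v) = c *: f0 u + f0 v.
Proof.
apply/ffunP => z; rewrite !ffunE; case: insub => [x|]; first by rewrite !ffunE.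
by rewrite scaler0 addr0.
Qed.

Lemma mem_vimg_f0 (S : {vspace chain (subX X)}) v :
  reflect (exists2 u, u \in S & v = f0 u) (v \in vimg (f0 (X:=X)) S).
Proof.
have E w : reflect (exists2 u, u \in S & w = f0 u)
    (w \in [seq f0 v | v <- [seq v <- enum {ffun (subX X) -> ('F_2)^o} | v \in S]]).
  apply: (iffP mapP) => -[u].
    by rewrite mem_filter => /andP[uS _] ->; exists u.
  by move=> uS ->; exists u; rewrite // mem_filter uS mem_enum.
rewrite span_closed; first exact: E.
  apply/E; exists 0; first exact: mem0v.
  by have := f0_linear (-1) 0 0; rewrite scaler0 addr0 scaleN1r addNr.
move=> c x y /E[u uS ->] /E[w wS ->]; apply/E; exists (c *: u + w).
  by rewrite rpredD// rpredZ.
by rewrite f0_linear.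
Qed.

Lemma f0_surj (v : chain Z) : (forall z, z \notin X -> v z = 0) -> exists u, v = f0 (X := X) u.
Proof.
move=> vX; exists [ffun x => v (val x)]; apply/ffunP => z; rewrite ffunE.
have [zX|zX] := boolP (z \in X); first by rewrite insubT ffunE.
by rewrite insubN// vX.
Qed.

(** Being killed over [X] forces support in [X], hence membership in the image of [f0]; so the
    filtration of PH_0(X) is read in chains of [Z]. *)
Lemma mem_vimg_kerp a v : (v \in vimg (f0 (X:=X)) (kerp (dX dZ (X:=X)) a))
  = killed dZ X a v.
Proof.
have sd x y : dX dZ (X:=X) x y = dX dZ (X:=X) y x by exact: dsym.
apply/mem_vimg_f0/idP => [[u]|kv]; first by rewrite mem_kerp// -f0_killed => ? ->.
have [u eu] := f0_surj (fun z => killed_supp (x := z) kv).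
by exists u => //; rewrite mem_kerp// -f0_killed -eu.
Qed.

Lemma mem_vimg_kerm a v : 0 < a -> (v \in vimg (f0 (X:=X)) (kerm (dX dZ (X:=X)) a))
  = `[< exists2 r, 0 <= r < a & killed dZ X r v >].
Proof.
move=> a0; have sd x y : dX dZ (X:=X) x y = dX dZ (X:=X) y x by exact: dsym.
apply/mem_vimg_f0/asboolP => [[u]|[r ra kv]].
  by rewrite mem_kerm// => /asboolP[r ra]; rewrite -f0_killed => ? ->; exists r.
have [u eu] := f0_surj (fun z => killed_supp (x := z) kv).
exists u => //; rewrite mem_kerm//; apply/asboolP; exists r => //.
by rewrite -f0_killed -eu.
Qed.

End Kernels.

(** * Death levels as ultrametric valuations *)

Section Levels.
Variables (R : realType) (T : finType) (d : T -> T -> R) (K : R) (x0 : T).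
Hypotheses (dmetric : is_metric d) (dK : forall x y, d x y < K).
Implicit Types (X : {set T}) (r : R) (u v : chain T).

(* The bound [K] exceeds all distances and stands for an infinite level. *)
Definition level X v : R :=
  \big[Num.min/K]_(p : T * T | killed d X (d p.1 p.2) v) d p.1 p.2.

Lemma level_leK X v : level X v <= K.
Proof. by rewrite /level bigmin_idl ge_min lexx. Qed.

Lemma level_ge0 X v : 0 <= level X v.
Proof.
have [d0 _] := dmetric; apply/bigmin_geP; split=> // .
by apply: le_trans (d0 x0 x0) (ltW (dK _ _)).
Qed.

Lemma level_attained X v : level X v < K ->
  exists2 p : T * T, killed d X (d p.1 p.2) v & level X v = d p.1 p.2.
Proof.
move=> lK; have [p0 kp0] : exists p : T * T, killed d X (d p.1 p.2) v.
  apply/existsP; apply: contraLR lK; rewrite negb_exists => /forallP nk.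
  by rewrite /level big_pred0 ?ltxx// => p; apply/negbTE/nk.
have dleK (p : T * T) : killed d X (d p.1 p.2) v -> d p.1 p.2 <= K.
  by move=> _; exact/ltW/dK.
by have [p kp e] := eq_bigmin p0 _ _ kp0 dleK; exists p.
Qed.

(** The graph at scale [r] is the graph at the largest distance not exceeding [r], which exists
    because [d x0 x0 = 0]. So the least distance at which [v] dies decides every scale. *)
Lemma killed_level X r v : 0 <= r ->
  killed d X r v = (level X v <= r) && (level X v < K).
Proof.
move=> r0; have [_ [dxx _]] := dmetric.
have d00 : d x0 x0 = 0 by apply/dxx.
apply/idP/andP => [kr|[lr lK]]; last first.
  have [p kp e] := level_attained lK; rewrite e in lr.
  exact: killed_le kp.
pose P := [pred p : T * T | d p.1 p.2 <= r].
have P0 : P (x0, x0) by rewrite /= d00.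
case: (@arg_maxP _ R _ (x0, x0) P (fun p => d p.1 p.2) P0) => p pr pmax.
have kp : killed d X (d p.1 p.2) v.
  apply/asboolP => g gl; move/asboolP: kr; apply => x y xX yX dxy.
  by apply: gl => //; exact: (pmax (x, y)).
have lp : level X v <= d p.1 p.2 by rewrite /level (bigmin_le_cond _ (j := p)).
by split; [apply: le_trans lp pr | apply: le_lt_trans lp (dK _ _)].
Qed.

Lemma killed_level_lt X r v :
  `[< exists2 s, 0 <= s < r & killed d X s v >] = (level X v < r) && (level X v < K).
Proof.
apply/asboolP/andP => [[s /andP[s0 sr]]|[lr lK]].
  by rewrite killed_level// => /andP[ls ->]; split=> //; exact: le_lt_trans sr.
by exists (level X v); rewrite ?lr ?level_ge0// killed_level ?lexx// level_ge0.
Qed.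

Lemma level_ultrametric X : ultrametric (level X).
Proof.
move=> c u v; set m := Num.max _ _.
have [mK|mK] := ltP m K; last exact: le_trans (level_leK _ _) mK.
have m0 : 0 <= m by rewrite le_max level_ge0.
have km w : level X w <= m -> killed d X m w.
  by move=> wm; rewrite killed_level// wm (le_lt_trans wm).
have ku : killed d X m u by rewrite km// le_max lexx.
have kv : killed d X m v by rewrite km// le_max lexx orbT.
by have := killed_lin c ku kv; rewrite killed_level// => /andP[].
Qed.

(** At scale 0 no two distinct points are joined, so all indicator functions are locally constant
    and only the zero chain is killed. *)
Lemma level_gt0 X v : v != 0 -> 0 < level X v.
Proof.
move=> v0; rewrite lt_neqAle level_ge0 andbT; apply: contra_neq v0 => l0.
have K0 : 0 < K by case: dmetric => d0 _; exact: le_lt_trans (d0 x0 x0) (dK _ _).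
have /asboolP kv : killed d X 0 v by rewrite killed_level// -l0 lexx.
apply/ffunP => x; have := kv (fun y => (y == x)%:R); rewrite (bigD1 x)//=.
rewrite eqxx mulr1 big1 ?addr0 ?ffunE; last by move=> y /negPf->; rewrite mulr0.
apply=> y z _ _ dyz; case: dmetric => d0 [dxx _].
by have /dxx-> : d y z = 0 by apply/eqP; rewrite eq_le dyz d0.
Qed.

End Levels.

(** * The matching diagram read off an adapted basis *)

Section Diagram.
Variables (R : realType) (Z : finType) (dZ : Z -> Z -> R) (X : {set Z}).
Variables (K : R) (x0 : Z).
Hypotheses (dmetric : is_metric dZ) (dK : forall x y, dZ x y < K).
Variables (n : nat) (e : n.-tuple (chain Z)).
Hypothesis be : basis_of fullv e.

Let lX := level dZ K X.
Let lZ := level dZ K [set: Z].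

Hypothesis e_adapted :
  forall v i, coord e i v != 0 -> lX e`_i <= lX v /\ lZ e`_i <= lZ v.

Let dsym x y : dZ x y = dZ y x.
Proof. by case: dmetric => _ [_ []]. Qed.

Let e_neq0 (i : 'I_n) : e`_i != 0.
Proof. by apply: (basis_not0 be); rewrite mem_nth// size_tuple. Qed.

Let lX_gt0 (i : 'I_n) : 0 < lX e`_i. Proof. exact: level_gt0. Qed.
Let lZ_gt0 (i : 'I_n) : 0 < lZ e`_i. Proof. exact: level_gt0. Qed.

(** A downward closed condition passes from [v] to the basis vectors in its expansion, and back
    because [W] is a subspace. The predicate [theta] covers strict and weak bounds alike. *)
Lemma bspan_level (w : chain Z -> R) (theta : pred R) (W : {vspace chain Z}) :
    (forall v i, coord e i v != 0 -> w e`_i <= w v) ->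
    (forall r s, r <= s -> theta s -> theta r) ->
    (forall v, (v \in W) = theta (w v)) ->
  W = bspan e [set i : 'I_n | theta (w e`_i)].
Proof.
move=> ew thle WE; apply/vspaceP => v; apply/idP/(mem_bspan be) => [vW i|vth].
  by move=> /ew /thle; rewrite inE; apply; rewrite -WE.
rewrite (coord_basis be (memvf v)); apply: rpred_sum => i _.
have [->|/vth] := eqVneq (coord e i v) 0; first by rewrite scale0r mem0v.
by rewrite inE => th; apply: rpredZ; rewrite WE.
Qed.

Let le_closed (a : R) r s : r <= s -> (s <= a) && (s < K) -> (r <= a) && (r < K).
Proof. by move=> rs /andP[sa sK]; rewrite (le_trans rs)// (le_lt_trans rs). Qed.

Let lt_closed (a : R) r s : r <= s -> (s < a) && (s < K) -> (r < a) && (r < K).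
Proof. by move=> rs /andP[sa sK]; rewrite !(le_lt_trans rs). Qed.

Lemma kerp_bspan b : 0 < b ->
  kerp dZ b = bspan e [set i : 'I_n | (lZ e`_i <= b) && (lZ e`_i < K)].
Proof.
move=> b0; apply: (bspan_level (theta := fun r => (r <= b) && (r < K))) => [v i||v].
- by case/e_adapted.
- exact: le_closed.
- by rewrite mem_kerp// (killed_level x0 dmetric dK)// ltW.
Qed.

Lemma kerm_bspan b : 0 < b ->
  kerm dZ b = bspan e [set i : 'I_n | (lZ e`_i < b) && (lZ e`_i < K)].
Proof.
move=> b0; apply: (bspan_level (theta := fun r => (r < b) && (r < K))) => [v i||v].
- by case/e_adapted.
- exact: lt_closed.
- by rewrite mem_kerm// (killed_level_lt x0 dmetric dK).
Qed.

Lemma vimg_kerp_bspan a : 0 < a -> vimg (f0 (X:=X)) (kerp (dX dZ (X:=X)) a) =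
  bspan e [set i : 'I_n | (lX e`_i <= a) && (lX e`_i < K)].
Proof.
move=> a0; apply: (bspan_level (theta := fun r => (r <= a) && (r < K))) => [v i||v].
- by case/e_adapted.
- exact: le_closed.
- by rewrite mem_vimg_kerp// (killed_level x0 dmetric dK)// ltW.
Qed.

Lemma vimg_kerm_bspan a : 0 < a -> vimg (f0 (X:=X)) (kerm (dX dZ (X:=X)) a) =
  bspan e [set i : 'I_n | (lX e`_i < a) && (lX e`_i < K)].
Proof.
move=> a0; apply: (bspan_level (theta := fun r => (r < a) && (r < K))) => [v i||v].
- by case/e_adapted.
- exact: lt_closed.
- by rewrite mem_vimg_kerm// (killed_level_lt x0 dmetric dK).
Qed.

Lemma card_setB (A B : {set 'I_n}) : B \subset A -> (#|A| - #|B|)%N = #|A :\: B|.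
Proof. by move=> /setIidPr BA; rewrite cardsD BA. Qed.

Lemma mbar_card b : 0 < b ->
  mbar dZ b = #|[set i : 'I_n | (lZ e`_i == b) && (b < K)]|.
Proof.
move=> b0; rewrite /mbar kerp_bspan// kerm_bspan// !(dim_bspan be) card_setB.
  congr #|pred_of_set _|; apply/setP => i; rewrite !inE.
  case: (ltgtP (lZ e`_i) b) => [_|_|->] //=; by rewrite ?andNb ?andbF.
by apply/subsetP => i; rewrite !inE => /andP[/ltW-> ->].
Qed.

(** In terms of index sets, the numerator is the quadrant below [(a, b)] and the denominator removes
    both of its open sides, leaving the vectors exactly at [(a, b)]. *)
Lemma M0_card a b : 0 < a -> 0 < b -> M0 dZ X a b =
  #|[set i : 'I_n | [&& lX e`_i == a, lZ e`_i == b, a < K & b < K]]|.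
Proof.
move=> a0 b0; rewrite /M0 a0 b0 /= vimg_kerp_bspan// vimg_kerm_bspan//.
rewrite kerp_bspan// kerm_bspan// !(bspanI be) (bspanU be) !(dim_bspan be) card_setB.
  congr #|pred_of_set _|; apply/setP => i; rewrite !inE.
  case: (ltgtP (lX e`_i) a) => [||->]; case: (ltgtP (lZ e`_i) b) => [||->];
    by case: (lX e`_i < K); case: (lZ e`_i < K); case: (a < K); case: (b < K).
by apply/subsetP => i; rewrite !inE =>
  /orP[/andP[/andP[/ltW-> ->] /andP[-> ->]]|/andP[/andP[-> ->] /andP[/ltW-> ->]]].
Qed.

(** Only values of [lX] on the basis contribute, so the sum runs over the finite list [r];
    exchanging sums, each basis vector is counted at its own value. *)
Lemma sum_M0_card b : 0 < b ->
  \sum_(a \in [set a : R | 0 < a]%classic) (M0 dZ X a b)%:Z =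
  (#|[set i : 'I_n | [&& lX e`_i < K, lZ e`_i == b & b < K]]|)%:Z.
Proof.
move=> b0; pose r := undup [seq lX e`_(val i) | i <- enum 'I_n].
have rP a : reflect (exists i : 'I_n, a = lX e`_i) (a \in r).
  rewrite mem_undup; apply: (iffP mapP) => [[i _ ->]|[i ->]]; first by exists i.
  by exists i; rewrite ?mem_enum.
have r_gt0 a : a \in r -> 0 < a by move=> /rP[i ->].
have rS : ([set` r] `<=` [set a : R | 0 < a])%classic by move=> a /r_gt0.
rewrite (fsbigE _ _ (undup_uniq _) rS) => [|a a0 ar]; last first.
  rewrite M0_card// eq_card0// => i; rewrite !inE.
  by apply: contraNF ar => /andP[/eqP<- _]; apply/rP; exists i.
rewrite big_seq_cond (eq_bigl (mem r)); last first.
  by move=> a; rewrite /= andb_idr// => /r_gt0 a0; exact/mem_set.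
rewrite -big_seq; under eq_big_seq => a /r_gt0 a0.
  rewrite M0_card// -natz -sum1_card natr_sum big_mkcond /=; over.
rewrite exchange_big -natz -sum1_card natr_sum [RHS]big_mkcond /=; apply: eq_bigr => i _.
have ir : lX e`_i \in r by apply/rP; exists i.
rewrite (bigD1_seq (lX e`_i)) ?undup_uniq//= big1 ?addr0.
  by rewrite !inE eqxx /= andbCA.
by move=> a ai; rewrite inE eq_sym (negPf ai).
Qed.

(** Level [K] over [X] means that the chain never dies there, that is, a = oo. *)
Definition key (i : 'I_n) : option R * R :=
  (if lX e`_i < K then Some (lX e`_i) else None, lZ e`_i).

(** For a = oo, removing from the bars of length [b] those with finite [lX] leaves the vectors at
    level [K]. Nonpositive coordinates occur on neither side, levels of basis vectors being
    positive. *)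
Lemma Dmult_card p :
  Dmult dZ X p = (#|[set i : 'I_n | (key i == p) && (lZ e`_i < K)]|)%:Z.
Proof.
have empty (P : pred 'I_n) : P =1 xpred0 -> 0 = (#|[set i | P i]|)%:Z.
  by move=> P0; rewrite eq_card0// => i; rewrite !inE P0.
case: p => oa b; rewrite /Dmult /=; case: ltP => [b0|b0]; last first.
  apply: empty => i; apply: contraTF b0 => /andP[/eqP[_ <-] _].
  by rewrite -ltNge.
case: oa => [a|]; last first.
  rewrite /Nf sum_M0_card// mbar_card//.
  set A := [set i | _]; set B := [set i | _].
  have sBA : B \subset A by apply/subsetP => i; rewrite !inE => /and3P[_ -> ->].
  rewrite subzn ?subset_leq_card// card_setB//; congr (_%:Z).
  congr #|pred_of_set _|; apply/setP => i; rewrite !inE /key xpair_eqE.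
  case: (ltP (lX _)) => //= _; first by rewrite andNb.
  by case: (eqVneq (lZ e`_i) b) => [->|].
have [a0|a0] := ltP 0 a; last first.
  rewrite /M0 ltNge a0 /=; apply: empty => i; apply: contraTF a0.
  rewrite /key; case: ltP => _ /andP[/eqP[] // <- _].
  by rewrite -ltNge.
rewrite M0_card//; congr (_%:Z); congr #|pred_of_set _|; apply/setP => i.
rewrite !inE /key xpair_eqE; case: (ltP (lX e`_i) K) => [lK|lK].
  rewrite -[Some _ == _]/(lX e`_i == a); case: eqP => //= ea.
  by rewrite -ea lK; case: eqP => //= ->.
by rewrite /=; case: eqP => //= ea; rewrite -ea ltNge lK andbF.
Qed.

End Diagram.

(** * Chain maps induced by maps of points *)

Section Pushforward.
Variables (Z Z' : finType) (h : Z -> Z').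

Definition push (v : chain Z) : chain Z' := [ffun z' => \sum_(z | h z == z') v z].

(** Pushing chains forward is adjoint to pulling functions back, so kernels can be compared through
    test functions alone. *)
Lemma push_pair v (g : Z' -> 'F_2) :
  \sum_z' push v z' * g z' = \sum_z v z * g (h z).
Proof.
rewrite [RHS](partition_big h predT)//=; apply: eq_bigr => z' _.
by rewrite ffunE mulr_suml; apply: eq_bigr => z /eqP->.
Qed.

Lemma push_sum (I : finType) (c : I -> 'F_2) (v : I -> chain Z) :
  push (\sum_i c i *: v i) = \sum_i c i *: push (v i).
Proof.
apply/ffunP => z'; rewrite ffunE sum_ffunE.
under eq_bigr do rewrite sum_ffunE; rewrite exchange_big /=.
apply: eq_bigr => i _; rewrite !ffunE scaler_sumr; apply: eq_bigr => z _.
by rewrite ffunE.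
Qed.

Variables (R : realType) (dZ : Z -> Z -> R) (dZ' : Z' -> Z' -> R).
Variables (X : {set Z}) (X' : {set Z'}) (delta : R).
Hypothesis hX : forall x, x \in X -> h x \in X'.
Hypothesis hd : forall x y, dZ' (h x) (h y) <= dZ x y + delta.

(** If [g] is locally constant at scale [r + delta], then its pullback along [h] is so at scale
    [r]. *)
Lemma killed_push r v : killed dZ X r v -> killed dZ' X' (r + delta) (push v).
Proof.
move=> /asboolP kv; apply/asboolP => g gl; rewrite push_pair; apply: kv.
move=> x y xX yX dxy; apply: gl; rewrite ?hX//.
by apply: le_trans (hd _ _) _; rewrite lerD2r.
Qed.

Lemma level_push (K : R) (z0 : Z) (z0' : Z') v :
    is_metric dZ -> is_metric dZ' -> (forall x y, dZ x y < K) ->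
    (forall x y, dZ' x y < K) -> 0 <= delta ->
  level dZ' K X' (push v) <= level dZ K X v + delta.
Proof.
move=> md md' dK dK' delta0.
have [lK|lK] := ltP (level dZ K X v) K; last first.
  by rewrite (le_trans (level_leK _ _ _ _))// (le_trans lK)// lerDl.
have l0 := level_ge0 z0 md dK X v.
have : killed dZ X (level dZ K X v) v by rewrite (killed_level z0 md dK)// lexx.
by move=> /killed_push; rewrite (killed_level z0' md' dK') ?addr_ge0// => /andP[].
Qed.

End Pushforward.

(** On [X], where [v] lives, a function locally constant at scale [delta] takes the same value at
    [x] and at [k (h x)]. *)
Lemma killed_return (R : realType) (Z Z' : finType) (dZ : Z -> Z -> R)
    (X : {set Z}) (h : Z -> Z') (k : Z' -> Z) (delta : R) (v : chain Z) :
    (forall x, x \in X -> k (h x) \in X) -> (forall x, dZ (k (h x)) x <= delta) ->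
    (forall x, x \notin X -> v x = 0) ->
  killed dZ X delta (push k (push h v) - v).
Proof.
move=> khX khd vX; apply/asboolP => g gl.
transitivity (\sum_x push k (push h v) x * g x - \sum_x v x * g x).
  by rewrite -sumrB; apply: eq_bigr => x _; rewrite -mulrBl !ffunE.
apply/eqP; rewrite subr_eq0 !push_pair; apply/eqP; apply: eq_bigr => x _.
have [xX|/vX->] := boolP (x \in X); last by rewrite !mul0r.
by rewrite (gl (k (h x)) x)// khX.
Qed.

(** * Matching the large points of one diagram into the other *)

Section OneSidedMatching.
Variables (R : realType) (Z Z' : finType) (dZ : Z -> Z -> R) (dZ' : Z' -> Z' -> R).
Variables (X : {set Z}) (X' : {set Z'}) (delta K : R) (z0 : Z) (z0' : Z').
Hypotheses (md : is_metric dZ) (md' : is_metric dZ').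
Hypotheses (dK : forall x y, dZ x y + delta < K) (dK' : forall x y, dZ' x y + delta < K).
Hypothesis delta_ge0 : 0 <= delta.
Variables (h : Z -> Z') (k : Z' -> Z).
Hypotheses (hX : forall x, x \in X -> h x \in X') (kX : forall x, x \in X' -> k x \in X).
Hypotheses (hd : forall x y, dZ' (h x) (h y) <= dZ x y + delta).
Hypotheses (kd : forall x y, dZ (k x) (k y) <= dZ' x y + delta).
Hypothesis khd : forall x, dZ (k (h x)) x <= delta.
Variables (n n' : nat) (e : n.-tuple (chain Z)) (e' : n'.-tuple (chain Z')).
Hypotheses (be : basis_of fullv e) (be' : basis_of fullv e').

Let lX := level dZ K X.
Let lZ := level dZ K [set: Z].
Let lX' := level dZ' K X'.
Let lZ' := level dZ' K [set: Z'].

Hypothesis e_adapted :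
  forall v i, coord e i v != 0 -> lX e`_i <= lX v /\ lZ e`_i <= lZ v.
Hypothesis e'_adapted :
  forall v i, coord e' i v != 0 -> lX' e'`_i <= lX' v /\ lZ' e'`_i <= lZ' v.

Definition near (i : 'I_n) (j : 'I_n') : bool :=
  (`|lX e`_i - lX' e'`_j| <= delta) && (`|lZ e`_i - lZ' e'`_j| <= delta).

(** The points that may stay unmatched; equality with [K] is the case a = oo. *)
Definition small (i : 'I_n) : bool :=
  ((lX e`_i == K) || (lX e`_i <= delta)) && (lZ e`_i <= delta).

Let dltK x y : dZ x y < K.
Proof. by apply: le_lt_trans (dK x y); rewrite lerDl. Qed.
Let dltK' x y : dZ' x y < K.
Proof. by apply: le_lt_trans (dK' x y); rewrite lerDl. Qed.

(** If [(a', b')] is far from both points, some coordinate drops by more than [delta] from [(a, b)]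
    to [(a', b')], and some coordinate does so from there to [(c, d)]. No coordinate rises by more
    than [delta] in either step, so [c + d < a + b]. *)
Lemma near_either (a b c d a' b' : R) :
    a' <= a + delta -> b' <= b + delta -> c <= a' + delta -> d <= b' + delta ->
    a + b <= c + d ->
  (`|a - a'| <= delta) && (`|b - b'| <= delta) || (`|c - a'| <= delta) && (`|d - b'| <= delta).
Proof.
move=> h1 h2 h3 h4 h5; rewrite !ler_norml.
have [u1|u1] := ltP (a' + delta) a; have [u2|u2] := ltP (b' + delta) b;
have [u3|u3] := ltP (c + delta) a'; have [u4|u4] := ltP (d + delta) b'; try lra.
Qed.

Let P i j := coord e' j (push h e`_(i : 'I_n)).
Let Q j l := coord e l (push k e'`_(j : 'I_n')).

Lemma coord_return (i l : 'I_n) : \sum_j P i j * Q j l = coord e l (push k (push h e`_i)).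
Proof.
rewrite [in RHS](coord_basis be' (memvf (push h e`_i))) push_sum linear_sum.
by apply: eq_bigr => j _; rewrite linearZ.
Qed.

(** The error [w] dies by [delta] over [Z], and also over [X] if [e_i] has finite level there; then
    every basis vector in its expansion is small. If [e_i] has infinite level over [X], the order of
    the sums excludes the finite levels of [e_l]. *)
Lemma coord_return_big (i l : 'I_n) : ~~ small l -> lX e`_i + lZ e`_i <= lX e`_l + lZ e`_l ->
  coord e l (push k (push h e`_i)) = (i == l)%:R.
Proof.
move=> bl sil; set w := push k (push h e`_i) - e`_i.
suff c0 : coord e l w = 0.
  have -> : push k (push h e`_i) = w + e`_i by rewrite subrK.
  by rewrite linearD /= c0 add0r; apply: coord_free; exact: basis_free be.
apply: contraNeq bl => /e_adapted[lXw lZw].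
have lZd : lZ e`_l <= delta.
  apply: le_trans lZw _.
  have : killed dZ [set: Z] delta w.
    by apply: killed_return => // x; rewrite in_setT.
  by rewrite (killed_level z0 md dltK)// => /andP[].
rewrite /small lZd andbT.
have [liK|liK] := ltP (lX e`_i) K.
  have ki : killed dZ X (lX e`_i) e`_i.
    by rewrite (killed_level z0 md dltK) ?lexx//; exact: level_ge0.
  have : killed dZ X delta w.
    apply: killed_return => // [x xX|x]; first by rewrite kX// hX.
    exact: killed_supp ki.
  rewrite (killed_level z0 md dltK)// => /andP[lXd _].
  by rewrite (le_trans lXw) ?orbT.
have [llK|llK] := ltP (lX e`_l) K; last first.
  by rewrite eq_le llK (level_leK dZ K).
(* A finite level is a distance, hence below [K - delta]; with [lZ e_l <= delta] the sum at [l]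
   stays below [K], against [sil]. *)
have [p _ lp] := level_attained dltK llK.
have := dK p.1 p.2; have lZi : 0 <= lZ e`_i by exact: (level_ge0 z0 md dltK).
move: sil; rewrite /lX lp -/lX.
have : lX e`_i >= K by [].
rewrite /lX; lra.
Qed.

Lemma near_hall (A : {set 'I_n}) : A \subset [set i | ~~ small i] ->
  (#|A| <= #|[set j | [exists i in A, near i j]]|)%N.
Proof.
move=> /subsetP Abig.
apply: (@triangular_product_card R _ _ _ P Q (fun i => lX e`_i + lZ e`_i)).
move=> i l iA lA sil; have := Abig _ lA; rewrite inE => bl.
rewrite -(coord_return_big bl sil) -coord_return [RHS](bigID (mem [set j | [exists i in A, near i j]])) /=.
(* Terms with [j] outside the neighbourhood vanish: were both factors nonzero, [near_either] would
   put [j] near [i] or near [l]. *)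
rewrite [X in _ + X]big1 ?addr0// => j; rewrite inE negb_exists => /forallP jN.
apply/eqP; apply: contraT; rewrite mulf_eq0 negb_or => /andP[/e'_adapted[h1 h2] /e_adapted[h3 h4]].
have h1' := le_trans h1 (level_push hX hd z0 z0' _ md md' dltK dltK' delta_ge0).
have h2' := le_trans h2 (level_push (fun x (_ : x \in [set: Z]) => in_setT (h x)) hd z0 z0' _ md md' dltK dltK' delta_ge0).
have h3' := le_trans h3 (level_push kX kd z0' z0 _ md' md dltK' dltK delta_ge0).
have h4' := le_trans h4 (level_push (fun x (_ : x \in [set: Z']) => in_setT (k x)) kd z0' z0 _ md' md dltK' dltK delta_ge0).
have := near_either h1' h2' h3' h4' sil.
by have := jN i; have := jN l; rewrite iA lA /= => /negPf + /negPf; rewrite /near => -> ->.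
Qed.

Lemma one_sided_matching (j0 : 'I_n') : exists f : 'I_n -> 'I_n',
  {in [set i | ~~ small i] &, injective f} /\
  (forall i, i \in [set i | ~~ small i] -> near i (f i)).
Proof. by apply: hall_marriage j0 _ => A; exact: near_hall. Qed.

End OneSidedMatching.

(** * From the Gromov-Hausdorff distance of pairs to maps *)

Section FiniteHausdorff.
Variables (R : realType) (M : Type) (dM : M -> M -> R).
Hypothesis mM : is_metric dM.

Lemma hausdorffC (A B : set M) : hausdorff dM A B = hausdorff dM B A.
Proof.
have [_ [_ [dC _]]] := mM.
rewrite /hausdorff maxC; congr (Num.max (sup _) (sup _)).
  apply: eq_imagel => b _; congr inf; apply: eq_imagel => a _; exact: dC.
apply: eq_imagel => b _; congr inf; apply: eq_imagel => a _; exact: dC.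
Qed.

(** By finiteness the distance from [g x] to the image of [A'] is attained, and the supremum of such
    distances is that of a bounded set. *)
Lemma hausdorff_close (T T' : finType) (g : T -> M) (g' : T' -> M)
    (A : set T) (A' : set T') x y : A x -> A' y ->
  exists2 y', A' y' & dM (g x) (g' y') <= hausdorff dM (g @` A)%classic (g' @` A')%classic.
Proof.
move=> Ax A'y; have [d0 _] := mM.
have A'y' : `[<A' y>] by apply/asboolP.
case: (@arg_minP _ R _ y (fun y => `[<A' y>]) (fun y => dM (g x) (g' y)) A'y').
move=> y' /asboolP A'y1 ymin; exists y' => //.
rewrite /hausdorff le_max; apply/orP; left.
apply: (@le_trans _ _ (inf (dM (g x) @` (g' @` A'))%classic)).
  apply: lb_le_inf; first by exists (dM (g x) (g' y)); exists (g' y) => //; exists y.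
  by move=> _ [_ [z A'z <-] <-]; apply: ymin; apply/asboolP.
apply: ub_le_sup; last by exists (g x) => //; exists x.
exists (\big[Num.max/0]_z dM (g z) (g' y)) => _ [_ [z Az <-] <-].
apply: le_trans (le_bigmax _ _ z); apply: ge_inf.
  by exists 0 => _ [w _ <-].
by exists (g' y) => //; exists y.
Qed.

End FiniteHausdorff.

Section DistancePair.
Variables (R : realType) (Z Z' : finType) (dZ : Z -> Z -> R) (dZ' : Z' -> Z' -> R).
Variables (X : {set Z}) (X' : {set Z'}) (x0 : Z) (x0' : Z').
Hypotheses (md : is_metric dZ) (md' : is_metric dZ').
Hypotheses (x0X : x0 \in X) (x0X' : x0' \in X').

(** A correspondence between the pairs, given by two maps. They are finite functions so that there
    are finitely many candidates [p]. *)
Definition distortion_le (delta : R) (p : {ffun Z -> Z'} * {ffun Z' -> Z}) : Prop :=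
  [/\ (forall x, x \in X -> p.1 x \in X') /\ (forall x, x \in X' -> p.2 x \in X),
      forall x y, dZ' (p.1 x) (p.1 y) <= dZ x y + delta,
      forall x y, dZ (p.2 x) (p.2 y) <= dZ' x y + delta,
      forall x, dZ (p.2 (p.1 x)) x <= delta
    & forall x, dZ' (p.1 (p.2 x)) x <= delta].

Lemma distortion_le_trans delta delta' p : delta <= delta' ->
  distortion_le delta p -> distortion_le delta' p.
Proof.
move=> dd [h1 h2 h3 h4 h5]; split=> // [x y|x y|x|x].
- by apply: le_trans (h2 x y) _; rewrite lerD2l.
- by apply: le_trans (h3 x y) _; rewrite lerD2l.
- exact: le_trans (h4 x) _.
- exact: le_trans (h5 x) _.
Qed.

Let GHset : set R := [set t : R | exists (M : Type) (dM : M -> M -> R) (g : Z -> M) (g' : Z' -> M),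
        [/\ is_metric dM, isometric dZ dM g, isometric dZ' dM g' &
        t = Num.max (hausdorff dM (g @` [set x | x \in X]) (g' @` [set x | x \in X']))
                    (hausdorff dM (g @` classical_sets.setT) (g' @` classical_sets.setT))]]%classic.

Lemma GHset_ge0 t : GHset t -> 0 <= t.
Proof.
move=> [M [dM [g [g' [mM _ _ ->]]]]].
have [y _ dxy] := @hausdorff_close _ _ _ mM _ _ g g' classical_sets.setT classical_sets.setT x0 x0' I I.
rewrite le_max; apply/orP; right; apply: le_trans dxy.
by case: mM => d0 _; exact: d0.
Qed.

(** On the disjoint union, let all cross distances equal a positive [D] bounding all distances in
    [Z] and [Z']; the triangle inequality then holds. *)
Lemma GHset_nonempty : (GHset !=set0)%classic.
Proof.
pose D := 1 + \big[Num.max/0]_(p : Z * Z) dZ p.1 p.2 +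
          \big[Num.max/0]_(p : Z' * Z') dZ' p.1 p.2.
have m0 : 0 <= \big[Num.max/0]_(p : Z * Z) dZ p.1 p.2 by apply: bigmax_ge_id.
have m0' : 0 <= \big[Num.max/0]_(p : Z' * Z') dZ' p.1 p.2 by apply: bigmax_ge_id.
have D0 : 0 < D by rewrite /D; lra.
have dD x y : dZ x y <= D.
  have := @le_bigmax _ _ _ 0 (fun p : Z * Z => dZ p.1 p.2) (x, y).
  by rewrite /D /=; lra.
have dD' x y : dZ' x y <= D.
  have := @le_bigmax _ _ _ 0 (fun p : Z' * Z' => dZ' p.1 p.2) (x, y).
  by rewrite /D /=; lra.
have [d0 [dxx [dC dt]]] := md; have [d0' [dxx' [dC' dt']]] := md'.
pose dM (a b : Z + Z') : R := match a, b with
  | inl x, inl y => dZ x y | inr x, inr y => dZ' x y | _, _ => D end.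
exists (Num.max (hausdorff dM (inl @` [set x | x \in X]) (inr @` [set x | x \in X']))
                (hausdorff dM (inl @` classical_sets.setT) (inr @` classical_sets.setT)))%classic.
exists (Z + Z')%type, dM, inl, inr; split=> //.
split; first by move=> [x|x] [y|y] /=; rewrite ?d0 ?d0' ?ltW.
split.
  move=> [x|x] [y|y] /=; first by rewrite dxx; split=> [->|[]].
  - by split=> // e; move: D0; rewrite e ltxx.
  - by split=> // e; move: D0; rewrite e ltxx.
  - by rewrite dxx'; split=> [->|[]].
split; first by move=> [x|x] [y|y] /=; rewrite 1?dC 1?dC'.
move=> [x|x] [y|y] [z|z] /=; rewrite ?dt ?dt'//.
- by rewrite lerDr d0.
- by have := dD x z; lra.
- by rewrite lerDl d0'.
- by rewrite lerDl d0.
- by have := dD' x z; lra.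
- by rewrite lerDr d0'.
Qed.

Lemma GHset_maps t : GHset t -> exists p, distortion_le (2 * t) p.
Proof.
move=> [M [dM [g [g' [mM ig ig' ->]]]]]; set t0 := Num.max _ _.
have [_ [_ [dC dt]]] := mM.
have closeX x : x \in X -> exists2 y, y \in X' & dM (g x) (g' y) <= t0.
  move=> xX; have [y yX dxy] := @hausdorff_close _ _ _ mM _ _ g g'
    [set x | x \in X]%classic [set x | x \in X']%classic x x0' xX x0X'.
  by exists y => //; rewrite le_max dxy.
have closeZ x : exists y, dM (g x) (g' y) <= t0.
  have [y _ dxy] := @hausdorff_close _ _ _ mM _ _ g g' classical_sets.setT classical_sets.setT x x0' I I.
  by exists y; rewrite le_max dxy orbT.
have closeX' x : x \in X' -> exists2 y, y \in X & dM (g y) (g' x) <= t0.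
  move=> xX; have [y yX] := @hausdorff_close _ _ _ mM _ _ g' g
    [set x | x \in X']%classic [set x | x \in X]%classic x x0 xX x0X.
  by rewrite (hausdorffC mM) dC => dxy; exists y => //; rewrite le_max dxy.
have closeZ' x : exists y, dM (g y) (g' x) <= t0.
  have [y _] := @hausdorff_close _ _ _ mM _ _ g' g classical_sets.setT classical_sets.setT x x0 I I.
  by rewrite (hausdorffC mM) dC => dxy; exists y; rewrite le_max dxy orbT.
(* Points of [X] are sent to close points of [X'], the others to any close point of [Z']. *)
have [h hP] : exists h : {ffun Z -> Z'}, forall x,
    (x \in X -> h x \in X') /\ dM (g x) (g' (h x)) <= t0.
  have /choice[h hP] : forall x, exists y, (x \in X -> y \in X') /\ dM (g x) (g' y) <= t0.
    move=> x; have [xX|xX] := boolP (x \in X).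
      by have [y] := closeX x xX; exists y.
    by have [y] := closeZ x; exists y.
  by exists [ffun x => h x] => x; rewrite ffunE.
have [k kP] : exists k : {ffun Z' -> Z}, forall x,
    (x \in X' -> k x \in X) /\ dM (g (k x)) (g' x) <= t0.
  have /choice[k kP] : forall x, exists y, (x \in X' -> y \in X) /\ dM (g y) (g' x) <= t0.
    move=> x; have [xX|xX] := boolP (x \in X').
      by have [y] := closeX' x xX; exists y.
    by have [y] := closeZ' x; exists y.
  by exists [ffun x => k x] => x; rewrite ffunE.
have hd x := (hP x).2; have kd x := (kP x).2.
exists (h, k); split=> /= [|x y|x y|x|x].
- by split=> x; [have [] := hP x|have [] := kP x].
- rewrite -ig' -ig; have := dt (g' (h x)) (g x) (g' (h y)).
  have := dt (g x) (g y) (g' (h y)); have := hd x; have := hd y.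
  by rewrite [dM (g' _) (g _)]dC; lra.
- rewrite -ig' -ig; have := dt (g (k x)) (g' x) (g (k y)).
  have := dt (g' x) (g' y) (g (k y)); have := kd x; have := kd y.
  by rewrite [dM (g' y) (g _)]dC; lra.
- rewrite -ig; have := dt (g (k (h x))) (g' (h x)) (g x).
  by have := hd x; have := kd (h x); rewrite [dM (g' _) (g _)]dC; lra.
- rewrite -ig'; have := dt (g' (h (k x))) (g (k x)) (g' x).
  by have := hd (k x); have := kd x; rewrite [dM (g' _) (g _)]dC; lra.
Qed.

(* There are finitely many pairs of maps, so a single one serves all values
   above the infimum. *)
Lemma dGH_pair_maps : exists p, distortion_le (2 * dGH_pair dZ X dZ' X') p.
Proof.
set eps := dGH_pair _ _ _ _.
have lim (u v : R) : (forall t, eps < t -> u <= v + 2 * t) -> u <= v + 2 * eps.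
  move=> ut; rewrite leNgt; apply/negP => lt.
  (* The midpoint of [eps] and [(u - v) / 2]. *)
  by have := ut ((eps + (u - v) / 2) / 2); lra.
have lim0 (u : R) : (forall t, eps < t -> u <= 2 * t) -> u <= 2 * eps.
  by move=> ut; have := lim u 0; rewrite add0r; apply => t; rewrite add0r; exact: ut.
apply: contrapT => /forallNP none.
(* The conditions are closed in [t], so a pair failing at [eps] already fails at some [t p > eps].
   An element of [GHset] below the least [t p] gives the contradiction. *)
have /choice[t tP] : forall p, exists t, eps < t /\ ~ distortion_le (2 * t) p.
  move=> p; apply: contrapT => /forallNP all; apply: (none p).
  have {}all t : eps < t -> distortion_le (2 * t) p.
    by move=> et; apply: contrapT => nd; apply: (all t).
  have [|h1 _ _ _ _] := all (eps + 1); first by rewrite ltrDl.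
  split=> // [x y|x y|x|x].
  - by apply: lim => s /all[].
  - by apply: lim => s /all[].
  - by apply: lim0 => s /all[].
  - by apply: lim0 => s /all[].
pose s := \big[Num.min/eps + 1]_p t p.
have es : eps < s.
  by apply/bigmin_gtP; split=> [|p _]; [rewrite ltrDl|exact: (tP p).1].
have GHinf : has_inf GHset.
  by split; [exact: GHset_nonempty|exists 0 => r /GHset_ge0].
have se : 0 < s - eps by rewrite subr_gt0.
have [r Gr rs] := inf_adherent se GHinf.
have [p] := GHset_maps Gr; move/(@distortion_le_trans _ (2 * t p)) => d.
apply: (tP p).2; apply: d; rewrite ler_pM2l//.
apply: (@le_trans _ _ s); last exact: bigmin_le.
by apply/ltW; rewrite (lt_le_trans rs)// addrC subrK.
Qed.

End DistancePair.

(** * Multiset representations indexed by basis vectors *)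

Section Representatives.
Variables (I : finType) (A : eqType) (f : I -> A) (S : {set I}).

Definition fiber (a : A) : {set I} := [set i | (f i == a) && (i \in S)].

(** The successor numbers each fiber from 1, as in Rep. *)
Definition rep (i : I) : A * nat := (f i, (index i (enum (fiber (f i)))).+1).

Lemma rep_inj : {in S &, injective rep}.
Proof.
move=> i j iS jS [fij]; rewrite fij => eij.
have mem l : l \in S -> f l = f j -> l \in enum (fiber (f j)).
  by move=> lS flj; rewrite mem_enum inE flj eqxx.
by rewrite -(nth_index i (mem i iS fij)) eij nth_index// mem.
Qed.

Lemma rep_le i : i \in S -> ((rep i).2 <= #|fiber (f i)|)%N.
Proof. by move=> iS; rewrite /= cardE index_mem mem_enum inE eqxx. Qed.

Lemma rep_onto a l : (1 <= l)%N -> (l <= #|fiber a|)%N ->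
  exists2 i, i \in S & rep i = (a, l).
Proof.
case: l => // l _ lt; have [i0 _] : exists i, i \in fiber a.
  by apply/set0Pn; rewrite -card_gt0 (leq_ltn_trans _ lt).
rewrite cardE in lt; have := mem_nth i0 lt; rewrite mem_enum inE => /andP[/eqP fa iS].
by exists (nth i0 (enum (fiber a)) l) => //; rewrite /rep fa index_uniq ?enum_uniq.
Qed.

End Representatives.

Section Representation.
Variables (R : realType) (Z : finType) (dZ : Z -> Z -> R) (X : {set Z}).
Variables (K : R) (x0 : Z) (n : nat) (e : n.-tuple (chain Z)).
Hypotheses (dmetric : is_metric dZ) (dK : forall x y, dZ x y < K).
Hypothesis be : basis_of fullv e.
Hypothesis e_adapted : forall v i, coord e i v != 0 ->
  level dZ K X e`_i <= level dZ K X v /\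
  level dZ K [set: Z] e`_i <= level dZ K [set: Z] v.

(** Leaves out the vectors that never die over [Z], which give no point of the diagram. *)
Definition finite_bars : {set 'I_n} := [set i : 'I_n | level dZ K [set: Z] e`_i < K].

Definition point (i : 'I_n) := rep (key dZ X K e) finite_bars i.

Lemma inRepP q :
  inRep dZ X q <-> exists2 i, i \in finite_bars & point i = q.
Proof.
have cardE p : Dmult dZ X p = (#|fiber (key dZ X K e) finite_bars p|)%:Z.
  rewrite (Dmult_card x0 dmetric dK be e_adapted); congr (_%:Z).
  by congr #|pred_of_set _|; apply/setP => i; rewrite !inE.
case: q => p l; rewrite /inRep cardE lez_nat; split=> [[l1 lp]|[i iS <-]].
  exact: rep_onto.
by split=> //; apply: rep_le.
Qed.

End Representation.

(** * Assembling the partial matching *)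

Lemma dim_chain_gt0 (T : finType) (x : T) : (0 < \dim {:chain T})%N.
Proof.
rewrite lt0n dimv_eq0; apply/negP => /eqP full0.
have : ([ffun=> 1] : chain T) \in fullv by exact: memvf.
by rewrite full0 memv0 => /eqP/ffunP/(_ x); rewrite !ffunE => /eqP; rewrite oner_eq0.
Qed.

Lemma distances_bounded (R : realType) (Z Z' : finType) (dZ : Z -> Z -> R)
    (dZ' : Z' -> Z' -> R) : exists B,
  (forall x y, dZ x y <= B) /\ (forall x y, dZ' x y <= B).
Proof.
exists (Num.max (\big[Num.max/0]_(p : Z * Z) dZ p.1 p.2)
                (\big[Num.max/0]_(p : Z' * Z') dZ' p.1 p.2)).
split=> x y; rewrite le_max.
  by have /= -> := @le_bigmax _ _ _ 0 (fun p : Z * Z => dZ p.1 p.2) (x, y).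
by have /= -> := @le_bigmax _ _ _ 0 (fun p : Z' * Z' => dZ' p.1 p.2) (x, y); rewrite orbT.
Qed.

(** Finite levels are distances, hence more than [delta] below [K], so no two [delta]-close levels
    are separated by [K]. *)
Lemma near_level_ltK (R : realType) (Z Z' : finType) (dZ : Z -> Z -> R)
    (dZ' : Z' -> Z' -> R) (delta K : R) Y Y' v v' :
    0 <= delta -> (forall x y, dZ x y + delta < K) -> (forall x y, dZ' x y + delta < K) ->
    `|level dZ K Y v - level dZ' K Y' v'| <= delta ->
  (level dZ K Y v < K) = (level dZ' K Y' v' < K).
Proof.
move=> delta0 dK dK'; rewrite ler_norml => /andP[h1 h2].
have dltK x y : dZ x y < K by apply: le_lt_trans (dK x y); rewrite lerDl.
have dltK' x y : dZ' x y < K by apply: le_lt_trans (dK' x y); rewrite lerDl.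
apply/idP/idP => lK.
  by have [p _ e] := level_attained dltK lK; have := dK p.1 p.2; lra.
by have [p _ e] := level_attained dltK' lK; have := dK' p.1 p.2; lra.
Qed.

Theorem theorem5p1 (R : realType)
  (Z : finType) (dZ : Z -> Z -> R) (X : {set Z})
  (Z' : finType) (dZ' : Z' -> Z' -> R) (X' : {set Z'}) (eps : R) :
  is_metric dZ -> is_metric dZ' -> X != finset.set0 -> X' != finset.set0 ->
  dGH_pair dZ X dZ' X' = eps ->
  exists sigma : (option R * R) * nat -> option ((option R * R) * nat),
    (* sigma is a partial matching Rep D(f_0) -/-> Rep D(f'_0) *)
    (forall p q, inRep dZ X p -> sigma p = Some q -> inRep dZ' X' q) /\
    (forall p1 p2 q, inRep dZ X p1 -> inRep dZ X p2 ->
       sigma p1 = Some q -> sigma p2 = Some q -> p1 = p2) /\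
    (* (i) *)
    (forall a b i a' b' j, inRep dZ X ((a, b), i) ->
       sigma ((a, b), i) = Some ((a', b'), j) ->
       ((a = None /\ a' = None) \/
        exists x x', [/\ a = Some x, a' = Some x' & `|x - x'| <= 2 * eps]) /\
       `|b - b'| <= 2 * eps) /\
    (* (ii) *)
    (forall a b i, inRep dZ X ((a, b), i) -> sigma ((a, b), i) = None ->
       (a = None \/ exists x, a = Some x /\ x <= 2 * eps) /\ b <= 2 * eps) /\
    (* (iii) *)
    (forall a' b' j, inRep dZ' X' ((a', b'), j) ->
       (forall p, inRep dZ X p -> sigma p <> Some ((a', b'), j)) ->
       (a' = None \/ exists x', a' = Some x' /\ x' <= 2 * eps) /\ b' <= 2 * eps).
Proof.
move=> md md' /set0Pn[x0 x0X] /set0Pn[x0' x0X'] <-.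
have [[h k]] := dGH_pair_maps md md' x0X x0X'.
move: (2 * _) => delta [/= [hX kX] hd kd khd hkd].
have delta0 : 0 <= delta.
  by case: md => d0 _; exact: le_trans (d0 _ _) (khd x0).
have [B [dB dB']] := distances_bounded dZ dZ'.
(* The margin above [B] exceeds [delta], which keeps infinite levels away from finite ones. *)
pose K := B + delta + 1.
have dK x y : dZ x y + delta < K by have := dB x y; rewrite /K; lra.
have dK' x y : dZ' x y + delta < K by have := dB' x y; rewrite /K; lra.
have dltK x y : dZ x y < K by apply: le_lt_trans (dK x y); rewrite lerDl.
have dltK' x y : dZ' x y < K by apply: le_lt_trans (dK' x y); rewrite lerDl.
have um Y := level_ultrametric x0 md dltK Y.
have um' Y := level_ultrametric x0' md' dltK' Y.
have [e [be ad]] := adapted_basis (um X) (um [set: Z]).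
have [e' [be' ad']] := adapted_basis (um' X') (um' [set: Z']).
pose i0 := Ordinal (dim_chain_gt0 x0); pose j0 := Ordinal (dim_chain_gt0 x0').
have [f [fI fN]] := one_sided_matching x0 x0' md md' dK dK' delta0 hX kX hd kd khd be be' ad ad' j0.
have [g [gI gN]] := one_sided_matching x0' x0 md' md dK' dK delta0 kX hX kd hd hkd be' be ad' ad i0.
pose N := near dZ dZ' X X' delta K e e'.
have gN' j : j \in [set j | ~~ small dZ' X' delta K e' j] -> N (g j) j.
  by move=> /gN; rewrite /N /near distrC [`|level _ _ setT _ - _|]distrC.
have [tau [tauN tauI tauS tauS']] := mendelsohn_dulmage fI fN gI gN'.
have nearK i j : N i j ->
    (level dZ K X e`_i < K) = (level dZ' K X' e'`_j < K) /\
    (level dZ K [set: Z] e`_i < K) = (level dZ' K [set: Z'] e'`_j < K).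
  by move=> /andP[n1 n2]; split; apply: near_level_ltK n1 || apply: near_level_ltK n2.
pose pt := point dZ X K e; pose pt' := point dZ' X' K e'.
have repP q := inRepP x0 md dltK be ad q.
have repP' q := inRepP x0' md' dltK' be' ad' q.
have ptI : {in finite_bars dZ K e &, injective pt} by exact: rep_inj.
have ptI' : {in finite_bars dZ' K e' &, injective pt'} by exact: rep_inj.
have finN i j : tau i = Some j ->
    (i \in finite_bars dZ K e) = (j \in finite_bars dZ' K e').
  by move=> /tauN/nearK[_ e2]; rewrite !inE.
(* [tau] is transported to the diagrams by the numberings [pt] and [pt'], which are injective on
   finite bars; by [finN], [tau] respects these. *)
pose sigma q := if [pick i in finite_bars dZ K e | pt i == q] is Some i
                then omap pt' (tau i) else None.
have sigmaE i : i \in finite_bars dZ K e -> sigma (pt i) = omap pt' (tau i).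
  move=> iF; rewrite /sigma; case: pickP => [j /andP[jF /eqP/ptI->//]|/(_ i)].
  by rewrite iF eqxx.
exists sigma; split; [|split; [|split; [|split]]].
- move=> p q /repP[i iF <-]; rewrite sigmaE//; case ti: (tau i) => [j|] //= [<-].
  by apply/repP'; exists j => //; rewrite -(finN _ _ ti).
- move=> p1 p2 q /repP[i iF <-] /repP[i' i'F <-]; rewrite !sigmaE//.
  case ti: (tau i) => [j|] // e1; case ti': (tau i') => [j'|] // e2.
  have /ptI' jj : pt' j' = pt' j by exact: (congr1 (odflt (pt' j)) (etrans e2 (esym e1))).
  have e12 : j' = j by apply: jj; rewrite -?(finN _ _ ti) -?(finN _ _ ti').
  by rewrite e12 in ti'; rewrite (tauI _ _ _ ti ti').
- move=> a b l a' b' l' /repP[i iF ei]; rewrite -ei sigmaE//.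
  case ti: (tau i) => [j|] // ej.
  have {}ej : pt' j = ((a', b'), l') := congr1 (odflt (pt' j)) ej.
  have /andP[n1 n2] := tauN _ _ ti; have [eK _] := nearK _ _ (tauN _ _ ti).
  (* By [eK] the first coordinates are both finite or both infinite. *)
  case: ei ej => <- <- _ [<- <- _]; split=> //; rewrite -eK.
  by case: ifP => _; [right; do 2!eexists; split|left].
- move=> a b l /repP[i iF ei]; rewrite -ei sigmaE//; case ti: (tau i) => [j|] // _.
  have : small dZ X delta K e i.
    by apply: contraT => ns; case: (tauS i) => //; rewrite inE.
  case: ei => <- <- _ /andP[sm ->]; split=> //; case: ifPn => lK; [right|by left].
  eexists; split=> //; case/orP: sm => [/eqP eK|//].
  by rewrite eK ltxx in lK.
- move=> a' b' l /repP'[j jF ej] un.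
  have : small dZ' X' delta K e' j.
    apply: contraT => ns; have [|i ti] := tauS' j; first by rewrite inE.
    case: (un (pt i)); first by apply/repP; exists i; rewrite ?(finN _ _ ti).
    by rewrite sigmaE ?(finN _ _ ti)// ti /= -ej.
  case: ej => <- <- _ /andP[sm ->]; split=> //; case: ifPn => lK; [right|by left].
  eexists; split=> //; case/orP: sm => [/eqP eK|//].
  by rewrite eK ltxx in lK.
Qed.
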